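(* Let $n \geq 2$. For all non-empty sets $F \subseteq \mathbb{R}^n$, $$\dim_{\mathrm{A}} D(F) \geq \min\{\dim_{\mathrm{A}} F-\theta, \, 1\},$$ where $\theta = \theta(\dim_{\mathrm{A}} F, n, 1)$.
   Context: The distance set of $F \subseteq \mathbb{R}^n$ is $D(F) = \{|x-y| : x,y \in F\} \subseteq [0,\infty)$. The Assouad dimension $\dim_{\mathrm{A}} F$ of $F\subseteq \mathbb{R}^n$ is the infimum of $\alpha \geq 0$ for which there is $C>0$ such that, for all $x \in F$ and $0<r<R$, the set $F \cap B(x,R)$ may be covered by fewer than $C(R/r)^\alpha$ sets of diameter $r$. $G(n,m)$ is the Grassmannian of $m$-dimensional linear subspaces of $\mathbb{R}^n$ (with its usual metric), $\pi_V$ is orthogonal projection of $\mathbb{R}^n$ onto $V\in G(n,m)$, and $\dim_{\mathrm{H}}$ is Hausdorff dimension. For integers $n>m\geq 1$ and $s \in [0,n]$, $$\theta(s,n,m) := \sup_{F} \dim_{\mathrm{H}} \{ V \in G(n,m) : \dim_{\mathrm{A}} \pi_V (F) < \min\{\dim_{\mathrm{A}} F, m\}\},$$ where the supremum is taken over all sets $F \subseteq \mathbb{R}^n$ with $\dim_{\mathrm{A}} F = s$ (the empty set having Hausdorff dimension $0$). *)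

(* Defs.v *)
From HB Require Import structures.
From mathcomp Require Import all_boot all_order all_algebra.
From mathcomp Require Import all_classical all_reals all_analysis.

Set Implicit Arguments.
Unset Strict Implicit.
Unset Printing Implicit Defensive.

Import Order.TTheory GRing.Theory Num.Theory.

Local Open Scope classical_set_scope.
Local Open Scope ring_scope.

(* The dimensions below take the distance [d] as an explicit argument, because
   the norm and topology that the library puts on ['rV[R]_n] come from the
   sup norm. *)
Section metric_dimensions.
Context {R : realType} {T : Type}.
Implicit Types (d : T -> T -> R) (E F U : set T).

(* The element 0 only serves to give the empty set diameter 0. *)
Definition diam d U : \bar R :=
  ereal_sup (0%E |` [set (d x y)%:E | x in U & y in U]).

Definition cball d (x : T) (rho : R) : set T := [set y | d x y <= rho].

(* The covering sets range over all subsets of [T] and have diameter exactly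
   [r]. In the Euclidean spaces used below (of dimension at least 1) every set
   of diameter less than [r] lies in one of diameter [r]. *)
Definition assouad_exponent d F (a : R) : Prop :=
  exists2 C : R, 0 < C & forall (x : T) (r rho : R), F x -> 0 < r -> r < rho ->
    exists (N : nat) (U : 'I_N -> set T),
      [/\ N%:R < C * (rho / r) `^ a,
          forall i, diam d (U i) = r%:E &
          F `&` cball d x rho `<=` \bigcup_i U i].

Definition dimA d F : \bar R :=
  ereal_inf [set a%:E | a in [set a : R | 0 <= a /\ assouad_exponent d F a]].

(* [0 `^ 0 = 1], hence the separate case: the empty set has measure 0 even for
   the exponent 0. *)
Definition diam_pow d (s : R) U : \bar R :=
  if `[< U = set0 >] then 0%E else (diam d U `^ s)%E.

Definition hausdorff_premeasure d (s delta : R) E : \bar R :=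
  ereal_inf [set (\sum_(0 <= i <oo) diam_pow d s (U i))%E |
    U in [set U : nat -> set T |
      (forall i, (diam d (U i) <= delta%:E)%E) /\ E `<=` \bigcup_i U i]].

Definition hausdorff_measure d (s : R) E : \bar R :=
  ereal_sup [set hausdorff_premeasure d s delta E |
    delta in [set delta : R | 0 < delta]].

Definition dimH d E : \bar R :=
  ereal_inf [set s%:E | s in
    [set s : R | 0 <= s /\ hausdorff_measure d s E = 0%E]].

End metric_dimensions.

Section euclidean.
Context {R : realType} {n : nat}.
Implicit Types (x y u v : 'rV[R]_n) (F : set 'rV[R]_n).
Implicit Types V W : {vspace 'rV[R]_n}.

Definition dotv u v : R := \sum_(i < n) u 0 i * v 0 i.

Definition enorm x : R := Num.sqrt (dotv x x).

Definition euclid_dist x y : R := enorm (x - y).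

Definition distance_set F : set R := [set euclid_dist x y | x in F & y in F].

Definition oproj V x : 'rV[R]_n :=
  xget 0 [set v | v \in V /\ forall w, w \in V -> dotv (x - v) w = 0].

Definition subspace_dist V W : R :=
  sup [set enorm (oproj V x - oproj W x) | x in [set x | enorm x <= 1]].

Lemma dotvDl u v w : dotv (u + v) w = dotv u w + dotv v w.
Proof.
by rewrite /dotv -big_split; apply: eq_bigr => i _; rewrite mxE mulrDl.
Qed.

Lemma dotvZl a u w : dotv (a *: u) w = a * dotv u w.
Proof.
by rewrite /dotv mulr_sumr; apply: eq_bigr => i _; rewrite mxE mulrA.
Qed.

Lemma dotvC u v : dotv u v = dotv v u.
Proof. by apply: eq_bigr => i _; rewrite mulrC. Qed.

Lemma dotvv_eq0 u : dotv u u = 0 -> u = 0.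
Proof.
move=> /eqP; rewrite psumr_eq0; last by move=> i _; rewrite -expr2 sqr_ge0.
move=> /allP u0; apply/rowP => i; rewrite mxE.
by have := u0 i (mem_index_enum _); rewrite /= mulf_eq0 orbb => /eqP.
Qed.

(* The set in the definition of [oproj] is a singleton. *)
Lemma oprojP V x :
  oproj V x \in V /\ forall w, w \in V -> dotv (x - oproj V x) w = 0.
Proof.
pose f u : 'rV[R]_(\dim V) := \row_i dotv u (vbasis V)`_i.
have f_lin : linear f.
  by move=> a u v; apply/rowP => i; rewrite !mxE dotvDl dotvZl.
pose fL := HB.pack_for {linear 'rV[R]_n -> 'rV[R]_(\dim V)} f
  (GRing.isLinear.Build _ _ _ _ f f_lin).
pose W := lker (linfun fL).
have WP u : u \in W -> forall w, w \in V -> dotv u w = 0.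
  rewrite memv_ker lfunE => /eqP fu0 w /coord_vbasis ->.
  rewrite dotvC; elim/big_ind : _ => [|a b a0 b0|i _].
  - by rewrite -(scale0r (0 : 'rV[R]_n)) dotvZl mul0r.
  - by rewrite dotvDl a0 b0 addr0.
  - have /rowP/(_ i) := fu0.
    by rewrite !mxE dotvZl dotvC => ->; rewrite mulr0.
have VW0 : (V :&: W = 0)%VS.
  apply/eqP; rewrite -subv0; apply/subvP => u; rewrite memv_cap memv0.
  by move=> /andP[uV uW]; apply/eqP/dotvv_eq0/WP.
have VWf : (V + W = fullv)%VS.
  apply/eqP; rewrite eqEdim subvf/= dimv_disjoint_sum//.
  have := limg_ker_dim (linfun fL) fullv; rewrite capfv -/W => <-.
  rewrite addnC leq_add2r (leq_trans (dimvS (subvf _)))//.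
  by rewrite dimvf /dim/= mul1n.
have /memv_addP[v vV [w wW xE]] : x \in (V + W)%VS by rewrite VWf memvf.
apply: (xgetPex 0 (P := [set v | v \in V /\ forall w, w \in V ->
  dotv (x - v) w = 0])).
exists v; split => // z zV; rewrite xE addrC addKr; exact: WP.
Qed.

Lemma oproj_unique V x v : v \in V ->
  (forall w, w \in V -> dotv (x - v) w = 0) -> oproj V x = v.
Proof.
move=> vV xv; have [pV xp] := oprojP V x.
apply/subr0_eq/dotvv_eq0.
have dV : oproj V x - v \in V by rewrite memvB.
have {1}-> : oproj V x - v = (x - v) + (-1) *: (x - oproj V x).
  by rewrite scaleN1r opprB [RHS]addrC addrA subrK.
by rewrite dotvDl dotvZl xv// xp// mulr0 addr0.
Qed.

End euclidean.

Definition grassmannian (R : realType) (n m : nat) :=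
  {V : {vspace 'rV[R]_n} | \dim V == m}.

(* The operator norm of the difference of the orthogonal projections. *)
Definition grassmannian_dist (R : realType) (n m : nat)
    (V W : grassmannian R n m) : R :=
  subspace_dist (sval V) (sval W).

Definition exceptional_set (R : realType) (n m : nat) (F : set 'rV[R]_n) :
    set (grassmannian R n m) :=
  [set V | (dimA euclid_dist (oproj (sval V) @` F) <
            mine (dimA euclid_dist F) m%:R%:E)%E].

Definition theta (R : realType) (s : \bar R) (n m : nat) : \bar R :=
  ereal_sup [set dimH (@grassmannian_dist R n m) (@exceptional_set R n m F) |
    F in [set F : set 'rV[R]_n | dimA euclid_dist F = s]].

(* The distance on the real line. *)
Definition real_dist (R : realType) (x y : R) : R := `|x - y|.

(* Main.v *)
Require Import Defs.
From mathcomp Require Import all_boot all_order all_algebra.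
From mathcomp Require Import ring lra.
From mathcomp Require Import all_classical all_reals all_analysis.

(** Let [s] be the Assouad dimension of [F], let [t] be an exponent for the
distance set [D(F)], and suppose that [t < 1] and [t + theta < s]. Call a ball
rich if [F] has large content of exponent [s] in it, in the sense that no cheap
cover by finitely many balls of not too small radii exists.

Rich balls occur inside rich balls ([nested_rich_balls]). If a rich ball never
contained the centre of a much smaller rich ball, then along every branch of
the process that refines covers ball by ball a rich ball would be met at most
once. At that moment a bounded factor is lost, and all other refinements are
governed by an exponent below [s], which would be an exponent for [F].

So there are balls [B(x_k, R_k)] and [B(y_k, r_k)], with [y_k] in the first one
and [r_k / R_k -> 0], that are richer and richer. Along a free ultrafilter, let
[E] be the limit of [(F - y_k) / R_k] and [T] the limit of [(F - y_k) / r_k]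
([limit_set]). Richness and compactness pass to the limits
([rich_limit_set]): [T] has dimension exactly [s] ([limit_set_dimA]), and
no cheap cover of exponent [s] exists for [E] near the origin.

Seen from a point of [F] near [y_k + R_k x], where [x] is a nonzero point of
[E], distances to points at scale [r_k] around [y_k] are, to first order,
orthogonal projections onto the line of [x]. Hence the projection of [T] onto
this line is a limit of rescaled pieces of [D(F)] and has dimension at most [t]
([projection_net_exponent]), less than [min(s, 1)]: the line is exceptional
for [T]. Thus the lines spanned by the points of [E] form a set of Hausdorff
dimension at most [theta], while the norms of the points of [E] obey the
exponent [t], because they are limits of rescaled distances as well
([limit_set_radial_exponent]). In polar coordinates this gives cheap covers of
[E] of exponent [s > theta + t] ([polar_cover]), a contradiction.

Exponents are carried from a set to its limits by packings
([limit_net_exponent]): a finite separated set in the limit is approximated, up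
to similarity, by a separated set of the same size. *)

Set Implicit Arguments.
Unset Strict Implicit.
Unset Printing Implicit Defensive.

Import Order.TTheory GRing.Theory Num.Theory.
Import numFieldTopology.Exports numFieldNormedType.Exports.

Local Open Scope classical_set_scope.
Local Open Scope ring_scope.

(** * Euclidean geometry *)

Section euclidean_geometry.
Context {R : realType} {n : nat}.
Implicit Types (x y u v w : 'rV[R]_n) (a b : R).

Lemma dotvDr u v w : dotv u (v + w) = dotv u v + dotv u w.
Proof. by rewrite dotvC dotvDl !(dotvC u). Qed.

Lemma dotvZr a u w : dotv u (a *: w) = a * dotv u w.
Proof. by rewrite dotvC dotvZl dotvC. Qed.

Lemma dotvNl u w : dotv (- u) w = - dotv u w.
Proof. by rewrite -scaleN1r dotvZl mulN1r. Qed.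

Lemma dotvNr u w : dotv u (- w) = - dotv u w.
Proof. by rewrite dotvC dotvNl dotvC. Qed.

Definition dotvE := (@dotvDl R n, dotvDr, @dotvZl R n, dotvZr, dotvNl, dotvNr).

Lemma dotvv_ge0 u : 0 <= dotv u u.
Proof. by apply: sumr_ge0 => i _; rewrite -expr2 sqr_ge0. Qed.

Lemma enorm_ge0 x : 0 <= enorm x.
Proof. exact: sqrtr_ge0. Qed.

Lemma enorm_sqr x : enorm x ^+ 2 = dotv x x.
Proof. by rewrite sqr_sqrtr// dotvv_ge0. Qed.

Lemma enormZ a x : enorm (a *: x) = `|a| * enorm x.
Proof.
by rewrite /enorm dotvZl dotvZr mulrA -expr2 sqrtrM ?sqr_ge0// sqrtr_sqr.
Qed.

Lemma enormN x : enorm (- x) = enorm x.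
Proof. by rewrite -scaleN1r enormZ normrN1 mul1r. Qed.

Lemma enorm0 : enorm (0 : 'rV[R]_n) = 0.
Proof. by rewrite -(scale0r 0) enormZ normr0 mul0r. Qed.

Lemma enorm_eq0 x : enorm x = 0 -> x = 0.
Proof. by move=> x0; apply: dotvv_eq0; rewrite -enorm_sqr x0 expr0n. Qed.

Lemma enorm_gt0 x : x != 0 -> 0 < enorm x.
Proof.
move=> x0; rewrite lt_neqAle enorm_ge0 andbT eq_sym.
by apply: contra x0 => /eqP/enorm_eq0 ->.
Qed.

Lemma cauchy_schwarz u v : `|dotv u v| <= enorm u * enorm v.
Proof.
have [->|v0] := eqVneq v 0.
  by rewrite -(scale0r (0 : 'rV_n)) dotvZr mul0r normr0 mulr_ge0 ?enorm_ge0.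
have vv : 0 < dotv v v by rewrite -enorm_sqr exprn_gt0// enorm_gt0.
rewrite -(@ler_pXn2r _ 2)// ?nnegrE ?mulr_ge0 ?enorm_ge0//.
rewrite exprMn !enorm_sqr real_normK ?num_real//.
have := dotvv_ge0 (dotv v v *: u - dotv u v *: v).
rewrite !dotvE (dotvC v u).
set p := dotv u u; set q := dotv v v; set c := dotv u v => h.
have : 0 <= q * (p * q - c ^+ 2) by apply: le_trans h _; lra.
by rewrite pmulr_rge0// subr_ge0.
Qed.

Lemma enorm_triangle u v : enorm (u + v) <= enorm u + enorm v.
Proof.
rewrite -(@ler_pXn2r _ 2)// ?nnegrE ?addr_ge0 ?enorm_ge0//.
rewrite sqrrD !enorm_sqr !dotvE (dotvC v u).
have := ler_norml (dotv u v) (enorm u * enorm v).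
rewrite cauchy_schwarz => /esym/andP[_ h].
rewrite -mulr_natr; lra.
Qed.

Lemma euclid_distC x y : euclid_dist x y = euclid_dist y x.
Proof. by rewrite /euclid_dist -enormN opprB. Qed.

Lemma euclid_dist_triangle y x z :
  euclid_dist x z <= euclid_dist x y + euclid_dist y z.
Proof.
rewrite /euclid_dist (le_trans _ (enorm_triangle _ _))//.
by rewrite addrA subrK.
Qed.

Lemma euclid_distxx x : euclid_dist x x = 0.
Proof. by rewrite /euclid_dist subrr enorm0. Qed.

(** This comparison connects the Euclidean distance with the topology of row
vectors, which is that of the sup norm. *)
Lemma enorm_coord x i : `|x 0 i| <= enorm x.
Proof.
rewrite -(@ler_pXn2r _ 2)// ?nnegrE ?enorm_ge0// enorm_sqr real_normK ?num_real//.
rewrite /dotv (bigD1 i)//= -expr2 lerDl sumr_ge0// => j _.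
by rewrite -expr2 sqr_ge0.
Qed.

Lemma cvg_dotv {T : Type} {U : set_system T} {UF : Filter U}
    (f g : T -> 'rV[R]_n) u v :
  f @ U --> u -> g @ U --> v -> (fun k => dotv (f k) (g k)) @ U --> dotv u v.
Proof.
move=> fu gv; rewrite /dotv.
apply: (@cvg_big _ _ (@GRing.add R)); first exact: add_continuous.
move=> i _; apply: cvgM.
  exact: (cvg_comp _ _ fu (@coord_continuous _ _ _ 0 i u)).
exact: (cvg_comp _ _ gv (@coord_continuous _ _ _ 0 i v)).
Qed.

Lemma cvg_enorm {T : Type} {U : set_system T} {UF : Filter U}
    (f : T -> 'rV[R]_n) u :
  f @ U --> u -> (fun k => enorm (f k)) @ U --> enorm u.
Proof.
move=> fu; rewrite /enorm.
exact: (cvg_comp _ _ (cvg_dotv fu fu) (@sqrt_continuous R _)).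
Qed.

Lemma euclid_dist_continuous x : continuous (euclid_dist x).
Proof.
move=> y; apply: (@cvg_enorm _ (nbhs y) _ (fun z => x - z) (x - y)).
by apply: cvgB; [exact: cvg_cst|exact: cvg_id].
Qed.

Lemma open_eball x a : open [set y | euclid_dist x y < a].
Proof.
apply: (@open_comp _ _ (euclid_dist x) [set t | t < a]) => //.
by move=> y _; exact: euclid_dist_continuous.
Qed.

Lemma compact_cball x a : compact (cball euclid_dist x a).
Proof.
have ccl : closed (cball euclid_dist x a).
  apply: (@closed_comp _ _ (euclid_dist x) [set t | t <= a]) => //.
  by move=> y _; exact: euclid_dist_continuous.
apply: (subclosed_compact ccl (@rV_compact _ n
  (fun i => `[(x 0 i - a), (x 0 i + a)]%classic) _)).
  by move=> i; exact: segment_compact.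
move=> y; rewrite /cball/= => xy i.
rewrite in_itv/= -ler_distlC; apply: le_trans xy.
by have := enorm_coord (x - y) i; rewrite !mxE.
Qed.

Lemma cvg_euclid {U : set_system nat} {UF : Filter U} (f : nat -> 'rV[R]_n) p :
  (forall e, 0 < e -> \forall k \near U, euclid_dist (f k) p < e) -> f @ U --> p.
Proof.
move=> fp; apply/cvg_ballP => e e0.
apply: filterS (fp _ e0) => k fke.
split=> // i j; rewrite /ball/= (ord1 i).
rewrite -normrN opprB.
apply: le_lt_trans fke.
by have := enorm_coord (f k - p) j; rewrite !mxE.
Qed.

End euclidean_geometry.

(** * Exponents of covering numbers and their passage to limits *)

Section covering_exponents.
Context {R : realType}.

Definition ball_cover {T : eqType} (d : T -> T -> R) (A : set T) (l : seq T)
    (r : R) :=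
  forall y, A y -> exists2 p, p \in l & d p y <= r.

(** Compared with [assouad_exponent], closed balls of radius [r] replace sets of
diameter exactly [r], which need not exist in a general metric space. *)
Definition net_exponent {T : eqType} (d : T -> T -> R) (F : set T) (a : R) :=
  exists2 C : R, 0 < C & forall (x : T) (r rho : R), F x -> 0 < r -> r < rho ->
    exists2 l : seq T, (size l)%:R <= C * (rho / r) `^ a &
      ball_cover d (F `&` cball d x rho) l r.

Lemma le_diam {T : Type} (d : T -> T -> R) (U : set T) (r : R) x y :
  (diam d U <= r%:E)%E -> U x -> U y -> d x y <= r.
Proof.
move=> dU Ux Uy; rewrite -lee_fin; apply: le_trans dU.
by apply: ereal_sup_ubound; right; exists x => //; exists y.
Qed.

Lemma assouad_net_exponent {T : eqType} (d : T -> T -> R) F a :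
  assouad_exponent d F a -> net_exponent d F a.
Proof.
move=> [C C0 FC]; exists C => // x r rho Fx r0 rrho.
have [N [U [NC dU FU]]] := FC x r rho Fx r0 rrho.
have /choice[g gU] : forall i, exists p, U i !=set0 -> U i p.
  move=> i; have [[y Uy]|U0] := pselect (U i !=set0).
    by exists y.
  by exists x.
exists [seq g i | i : 'I_N]; first by rewrite size_map -cardE card_ord ltW.
move=> y /FU[i _ Uiy]; exists (g i); first by rewrite map_f ?mem_enum.
by apply: (le_diam _ (gU i _) Uiy); [rewrite dU|exists y].
Qed.

Lemma near_all_seq {T : eqType} {U : set_system nat} {UF : Filter U} (l : seq T)
    (P : T -> nat -> Prop) :
  (forall p, p \in l -> \forall k \near U, P p k) ->
  \forall k \near U, forall p, p \in l -> P p k.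
Proof.
elim: l => [_|q l IH Pl]; first exact: filterE.
have Pq := Pl q (mem_head _ _).
have Pt : \forall k \near U, forall p, p \in l -> P p k.
  by apply: IH => p pl; apply: Pl; rewrite inE pl orbT.
apply: filterS2 Pq Pt => k Pqk Plk p.
by rewrite inE => /predU1P[->//|]; exact: Plk.
Qed.

(** A separated set of the largest possible size is a net, because no point can
be added to it. *)
Lemma maximal_separated {T : eqType} (d : T -> T -> R) (A : set T) (r c : R) :
  0 <= c ->
  (forall S, pairwise (fun p q => r < d p q) S -> (forall p, p \in S -> A p) ->
    (size S)%:R <= c) ->
  exists2 S : seq T, (size S)%:R <= c & ball_cover d A S r.
Proof.
move=> c0 sepc; apply: contrapT => noS.
have big m : exists S, [/\ pairwise (fun p q => r < d p q) S,
    forall p, p \in S -> A p & size S = m].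
  elim: m => [|m [S [Ssep SA Sm]]]; first by exists [::].
  have /not_andP[|/existsNP[y /not_implyP[Ay ny]]] :
    ~ ((size S)%:R <= c /\ ball_cover d A S r) by case=> h1 h2; apply: noS; exists S.
    by case; exact: sepc.
  exists (rcons S y); split.
  - rewrite pairwise_rcons Ssep andbT; apply/allP => p pS.
    by rewrite ltNge; apply/negP => pr; apply: ny; exists p.
  - by move=> p; rewrite mem_rcons inE => /predU1P[->//|/SA].
  - by rewrite size_rcons Sm.
have [S [Ssep SA Sm]] := big (Num.bound c).
have := archi_boundP c0.
by rewrite -Sm ltNge sepc.
Qed.

(** A separated subset of a ball of [A] is mapped by some [f k], up to the scale
[lam k], to a separated subset of a ball of [B], and a ball of half the
separation contains at most one of its points. So the exponent of [B] bounds the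
size of packings in [A], hence also the size of covers. *)
Lemma limit_net_exponent {T1 T2 : eqType} (d1 : T1 -> T1 -> R)
    (d2 : T2 -> T2 -> R) (A : set T1) (B : set T2) {U : set_system nat}
    {UF : ProperFilter U} (lam : nat -> R) (f : nat -> T1 -> T2) a :
  (forall x y z, d2 x z <= d2 x y + d2 y z) -> (forall x y, d2 x y = d2 y x) ->
  0 <= a ->
  (forall k, 0 < lam k) -> (forall k x, A x -> B (f k x)) ->
  (forall x y, A x -> A y ->
    (fun k => lam k * d2 (f k x) (f k y)) @ U --> d1 x y) ->
  net_exponent d2 B a -> net_exponent d1 A a.
Proof.
move=> tri sym a0 lam0 fB flim [C C0 BC].
exists (C * 4 `^ a); first by rewrite mulr_gt0// powR_gt0.
move=> x r rho Ax r0 rrho.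
have rho0 : 0 < rho by exact: lt_trans rrho.
apply: maximal_separated.
  by rewrite !mulr_ge0 ?powR_ge0// ltW.
move=> S Ssep SA.
have near1 : \forall k \near U, forall p, p \in S ->
    lam k * d2 (f k x) (f k p) < 2 * rho.
  apply: near_all_seq => p pS; have [Ap xp] := SA p pS.
  apply: (cvgr_lt _ (flim x p Ax Ap)).
  by rewrite (le_lt_trans xp)// mulr_natl mulr2n ltrDl.
have near2 : \forall k \near U, forall p, p \in S -> forall q, q \in S ->
    r < d1 p q -> r < lam k * d2 (f k p) (f k q).
  apply: near_all_seq => p pS; apply: near_all_seq => q qS.
  have [Ap _] := SA p pS; have [Aq _] := SA q qS.
  have [rpq|rpq] := ltP r (d1 p q); last first.
    exact: filterE.
  by apply: filterS (cvgr_gt _ (flim p q Ap Aq) _ rpq).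
have [k [k1 k2]] := filter_ex (filterI near1 near2).
have lk := lam0 k.
have [l lsize lcov] : exists2 l : seq T2, (size l)%:R <=
    C * ((2 * rho / lam k) / (r / 2 / lam k)) `^ a &
    ball_cover d2 (B `&` cball d2 (f k x) (2 * rho / lam k)) l (r / 2 / lam k).
  apply: BC; [exact: fB|by rewrite !divr_gt0|].
  by rewrite ltr_pM2r ?invr_gt0//; lra.
have ratio : (2 * rho / lam k) / (r / 2 / lam k) = 4 * (rho / r).
  by field; rewrite !gt_eqF.
have ratio0 : 0 <= rho / r by rewrite divr_ge0// ltW.
rewrite ratio powRM// mulrA in lsize.
apply: le_trans lsize; rewrite ler_nat.
have /choice[g gl] : forall p, exists q, p \in S ->
    q \in l /\ d2 q (f k p) <= r / 2 / lam k.
  move=> p; have [pS|] := boolP (p \in S); last by exists (f k x).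
  have [|q ql qp] := lcov (f k p); last by exists q.
  split; first by apply: fB; have [] := SA p pS.
  by rewrite /cball/= ler_pdivlMr// mulrC ltW// k1.
rewrite -(size_map g); apply: uniq_leq_size; last first.
  by move=> _ /mapP[p pS ->]; have [] := gl p pS.
rewrite uniq_pairwise pairwise_map.
move: Ssep; apply: sub_in_pairwise (allss S) => p q pS qS rpq /=.
apply/eqP => gpq.
have [_ h1] := gl p pS; have [_] := gl q qS; rewrite -gpq => h2.
have := k2 p pS q qS rpq; apply/negP; rewrite -leNgt.
rewrite mulrC -ler_pdivlMr//.
apply: le_trans (tri _ (g p) _) _; rewrite (sym _ (g p)).
by have := lerD h1 h2; rewrite -mulrDl -splitr.
Qed.

End covering_exponents.

(** * Covers by balls in Euclidean space *)

Section euclidean_coverings.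
Context {R : realType} {n : nat}.
Implicit Types (x y p : 'rV[R]_n) (F A : set 'rV[R]_n) (r rho eta u s : R).
Implicit Types (l : seq ('rV[R]_n * R)).

(** In positive dimension, balls provide sets of any prescribed diameter. *)
Lemma diam_cball p r : (0 < n)%N -> 0 < r ->
  diam euclid_dist (cball euclid_dist p (r / 2)) = r%:E.
Proof.
move=> n0 r0; apply/eqP; rewrite eq_le; apply/andP; split.
  apply: ge_ereal_sup => _ [->|[x px [y py <-]]]; first by rewrite lee_fin ltW.
  rewrite lee_fin (le_trans (euclid_dist_triangle p _ _))//.
  by rewrite (euclid_distC x) [leRHS]splitr lerD.
pose e : 'rV[R]_n := delta_mx 0 (Ordinal n0).
have e1 : enorm e = 1.
  rewrite /enorm /dotv (bigD1 (Ordinal n0))//= big1 => [|i /negPf i0].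
    by rewrite !mxE !eqxx mulr1 addr0 sqrtr1.
  by rewrite !mxE i0 andbF mulr0.
apply: ereal_sup_ubound; right.
have r2 : 0 <= r / 2 by rewrite divr_ge0// ltW.
exists (p + (r / 2) *: e).
  rewrite /cball/= /euclid_dist opprD addrA subrr add0r enormN enormZ e1 mulr1.
  by rewrite ger0_norm.
exists (p - (r / 2) *: e).
  rewrite /cball/= /euclid_dist opprB addrC subrK enormZ e1 mulr1.
  by rewrite ger0_norm.
rewrite /euclid_dist opprB addrC -addrA (addrA _ p) addNr add0r -scalerDl -splitr.
by rewrite enormZ e1 mulr1 gtr0_norm.
Qed.

Lemma net_assouad_exponent F a : (0 < n)%N -> 0 <= a ->
  net_exponent euclid_dist F a -> assouad_exponent euclid_dist F a.
Proof.
move=> n0 a0 [C C0 FC].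
exists (C * 2 `^ a + 1); first by rewrite addr_gt0// mulr_gt0// powR_gt0.
move=> x r rho Fx r0 rrho.
have ratio0 : 0 < rho / r by rewrite divr_gt0// (lt_trans r0).
have [||l lsize lcov] := FC x (r / 2) rho Fx; [by lra..|].
exists (size l), (fun i => cball euclid_dist (tnth (in_tuple l) i) (r / 2)); split.
- apply: le_lt_trans lsize _.
  rewrite (_ : rho / (r / 2) = 2 * (rho / r)); last by field; rewrite gt_eqF.
  rewrite powRM ?(ltW ratio0)// mulrA mulrDl mul1r ltrDl.
  exact: powR_gt0.
- by move=> i; exact: diam_cball.
- move=> y /lcov[p /seq_tnthP[i ->] py]; exists i => //.
Qed.

Definition cover_cost s l : R := \sum_(b <- l) (2 * b.2) `^ s.

(** A cover of [A `&` cball x rho] whose radii are given relative to [rho], so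
that the cost of the cover is invariant under similarities. *)
Definition relative_cover A x rho l :=
  forall y, A y -> cball euclid_dist x rho y ->
    exists2 b, b \in l & cball euclid_dist b.1 (b.2 * rho) y.

(** The bound [c] is a real number, since it arises as [C * (rho / r) `^ u]. *)
Definition bounded_cover A (c r : R) :=
  exists2 L : seq 'rV[R]_n, (size L)%:R <= c & ball_cover euclid_dist A L r.

Lemma bounded_cover_seq {T : eqType} (A : set 'rV[R]_n) (B : T -> set 'rV[R]_n)
    (c : T -> R) r (l : seq T) :
  A `<=` \bigcup_(b in [set` l]) B b ->
  (forall b, b \in l -> bounded_cover (A `&` B b) (c b) r) ->
  bounded_cover A (\sum_(b <- l) c b) r.
Proof.
move=> AB lB.
suff : bounded_cover (A `&` \bigcup_(b in [set` l]) B b) (\sum_(b <- l) c b) r.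
  by rewrite (_ : A `&` _ = A)//; exact/setIidPl.
elim: l lB {AB} => [_|b l IH lB].
  by exists [::]; rewrite ?big_nil// => y [_ []].
have [L1 s1 c1] := lB b (mem_head _ _).
have [|L2 s2 c2] := IH; first by move=> q ql; apply: lB; rewrite inE ql orbT.
exists (L1 ++ L2); first by rewrite size_cat big_cons natrD lerD.
move=> y [Ay [q /=]]; rewrite inE => /predU1P[->|ql] Bqy.
  by have [//|p pL py] := c1 y; exists p => //; rewrite mem_cat pL.
have [|p pL py] := c2 y; first by split=> //; exists q.
by exists p => //; rewrite mem_cat pL orbT.
Qed.

Lemma bounded_coverS A B c c' r : A `<=` B -> c <= c' ->
  bounded_cover B c r -> bounded_cover A c' r.
Proof.
move=> AB cc' [L Lc LB]; exists L; first exact: le_trans cc'.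
by move=> y /AB; exact: LB.
Qed.

Lemma bounded_cover0 A r : ~ (A !=set0) -> bounded_cover A 0 r.
Proof. by move=> A0; exists [::] => // y Ay; case: A0; exists y. Qed.

(** Replacing a ball by a relative cover of cost at most 1 for the exponent [u]
does not increase the sum of the [rho `^ u], so covers can be refined until
all radii are comparable with [r], at which point their number is controlled by
[(rho / r) `^ u]. Replacing the centre of a ball by a point of [A] doubles its
radius; this is why costs are computed with [2 * b.2]. The second alternative of
the hypothesis lets the refinement stop early at a ball for which the bound is
already known. *)
Lemma iterate_covers A eta u C R0 : 0 < eta -> 0 <= u -> eta `^ (- u) <= C ->
  (forall x rho, A x -> 0 < rho -> rho <= R0 ->
    (exists l, [/\ forall b, b \in l -> eta <= b.2 /\ 2 * b.2 <= 2^-1,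
       cover_cost u l <= 1 & relative_cover A x rho l]) \/
    (forall r, 0 < r -> r < rho ->
       bounded_cover (A `&` cball euclid_dist x rho) (C * (rho / r) `^ u) r)) ->
  forall x r rho, A x -> 0 < r -> rho <= R0 -> eta * r <= rho ->
    bounded_cover (A `&` cball euclid_dist x rho) (C * (rho / r) `^ u) r.
Proof.
move=> eta0 u0 etaC step x r rho Ax r0 rhoR0 r_rho.
have C0 : 0 <= C by apply: le_trans etaC; exact: powR_ge0.
have [j] : exists j, rho <= r * 2 ^+ j.
  exists (Num.bound (rho / r)); rewrite mulrC -ler_pdivrMr//.
  have rr0 : 0 <= rho / r.
    by rewrite divr_ge0 ?ltW// (lt_le_trans _ r_rho)// mulr_gt0.
  apply: (le_trans (ltW (archi_boundP rr0))).
  by rewrite -natrX ler_nat ltnW// ltn_expl.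
(* Each refinement at least halves the radius. *)
elim: j => [|j IH] in x rho Ax rhoR0 r_rho *.
  rewrite expr0 mulr1 => rho_r.
  exists [:: x]; last first.
    by move=> y [_ xy]; exists x; rewrite ?mem_head// (le_trans xy).
  have -> : (size [:: x])%:R = eta `^ (- u) * eta `^ u :> R.
    by rewrite powRN mulVf// gt_eqF// powR_gt0.
  rewrite ler_pM ?powR_ge0//.
  by rewrite ge0_ler_powR// ?nnegrE ?(ltW eta0)// ?divr_ge0 ?(ltW r0)//
    ?ler_pdivlMr// (le_trans _ r_rho)// mulr_ge0// ltW.
move=> rho_j.
have rho0 : 0 < rho by apply: lt_le_trans r_rho; exact: mulr_gt0.
have [rho_r|r_lt] := leP rho r.
  apply: IH => //; apply: le_trans rho_r _.
  by rewrite ler_peMr ?(ltW r0)// exprn_ege1// ler1n.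
have [[l [lb lcost lcov]]|] := step x rho Ax rho0 rhoR0; last exact.
have : bounded_cover (A `&` cball euclid_dist x rho)
    (\sum_(b <- l) (C * (rho / r) `^ u * (2 * b.2) `^ u)) r.
  apply: (@bounded_cover_seq _ _ (fun b => cball euclid_dist b.1 (b.2 * rho))).
    by move=> y [Ay xy]; have [b bl yb] := lcov y Ay xy; exists b.
  move=> b /lb[eta_b b_half].
  have c0 : 0 <= C * (rho / r) `^ u * (2 * b.2) `^ u.
    by rewrite !mulr_ge0 ?powR_ge0.
  have [[z [[Az _] bz]]|N0] := pselect
    (A `&` cball euclid_dist x rho `&` cball euclid_dist b.1 (b.2 * rho) !=set0);
    last exact: bounded_coverS (bounded_cover0 r N0).
  have b0 : 0 <= 2 * b.2 by lra.
  have := IH z (2 * b.2 * rho) Az.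
  have -> : C * (rho / r) `^ u * (2 * b.2) `^ u =
      C * (2 * b.2 * rho / r) `^ u.
    rewrite -mulrA -powRM ?divr_ge0 ?(ltW r0) ?(ltW rho0)//.
    by congr (_ * _ `^ _); ring.
  move=> H; apply: bounded_coverS (H _ _ _) => //.
  - move=> y [[Ay _] by_]; split=> //; rewrite /cball/=.
    apply: le_trans (euclid_dist_triangle b.1 _ _) _.
    by rewrite -mulrA mulr_natl mulr2n lerD// euclid_distC.
  - by apply: le_trans rhoR0; nra.
  - by nra.
  - move: rho_j; rewrite exprS; nra.
apply: bounded_coverS => //.
by rewrite -mulr_sumr ler_piMr// mulr_ge0 ?powR_ge0.
Qed.

(** Balls of [R^n] are doubling, by compactness of the unit ball. *)
Lemma euclidean_doubling eta : 0 < eta ->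
  exists K : nat, forall x rho, 0 < rho ->
    bounded_cover (cball euclid_dist x rho) K%:R (eta * rho).
Proof.
move=> eta0.
have := @compact_cball R n 0 1; rewrite compact_cover => /(_ _ setT
  (fun x => [set y | euclid_dist x y < eta])).
case=> [x _|y _|D _ Dcov]; first exact: open_eball.
  by exists y => //=; rewrite euclid_distxx.
exists (size (finmap.enum_fset D)) => x rho rho0.
exists [seq x + rho *: p | p <- finmap.enum_fset D]; first by rewrite size_map.
move=> y xy.
have [|p pD py] := Dcov (rho^-1 *: (y - x)).
  rewrite /cball/= /euclid_dist sub0r enormN enormZ gtr0_norm ?invr_gt0//.
  by rewrite ler_pdivrMl// mulr1 -enormN opprB.
exists (x + rho *: p); first exact: map_f.
have -> : euclid_dist (x + rho *: p) y = rho * euclid_dist p (rho^-1 *: (y - x)).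
  rewrite /euclid_dist -{2}(gtr0_norm rho0) -enormZ scalerBr scalerA.
  by rewrite mulfV ?gt_eqF// scale1r opprB addrCA addrA.
by rewrite mulrC ler_pM2r// ltW.
Qed.

(** With [K] balls of a quarter of the radius in each refinement, the cost is
[K / 2 ^ u], which is at most 1 for [u = K]. *)
Lemma euclidean_finite_exponent F :
  exists2 u, 0 <= u & net_exponent euclid_dist F u.
Proof.
have [|K Kcov] := @euclidean_doubling 4^-1; first by rewrite invr_gt0.
exists K%:R => //; exists (4^-1 `^ - K%:R); first by rewrite powR_gt0 ?invr_gt0.
move=> x r rho Fx r0 r_rho.
apply: (@iterate_covers F 4^-1 K%:R _ rho) => //; last by nra.
  move=> {Fx r0 r_rho r} y t Fy t0 _; left.
  have [L LK Lcov] := Kcov y t t0.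
  exists [seq (p, 4^-1) | p <- L]; split.
  - by move=> _ /mapP[p _ ->] /=; split=> //; lra.
  - rewrite /cover_cost big_map /= (eq_bigr (fun=> 2^-1 `^ K%:R)); last first.
      by move=> p _; congr (_ `^ _); lra.
    rewrite big_const_seq count_predT iter_addr_0.
    rewrite powR_mulrn ?invr_ge0// -[_ *+ size L]mulr_natl exprVn.
    rewrite ler_pdivrMr ?exprn_gt0//.
    rewrite mul1r (le_trans LK)// -natrX ler_nat ltnW// ltn_expl//.
  - move=> z _ /Lcov[p pL pz]; exists (p, 4^-1) => //.
    by apply: map_f.
Qed.

End euclidean_coverings.

(** * Rich balls *)

Section rich_balls.
Context {R : realType} {n : nat}.
Implicit Types (x y p : 'rV[R]_n) (F A : set 'rV[R]_n) (r rho eta u s : R).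

(** A ball is rich for [F] when it is not cheaply covered. The threshold for the
cost is chosen so that every radius of a cheap cover is at most a quarter of
[rho] and the cost stays below 1 for exponents slightly smaller than [s]. *)
Definition cheaply_covered F s eta x rho :=
  exists l, [/\ forall b, b \in l -> eta <= b.2,
    cover_cost s l <= 2^-1 `^ s / 2 & relative_cover F x rho l].

Lemma powR_le1 (a s : R) : 0 <= a <= 1 -> 0 <= s -> a `^ s <= 1.
Proof.
move=> /andP[a0 a1] s0.
have <- : 1 `^ s = 1 :> R by rewrite powR1.
by rewrite ge0_ler_powR ?nnegrE.
Qed.

Lemma powR_half_le eta s : 0 < eta -> 0 < s ->
  exists2 u, 0 <= u < s & 2^-1 <= eta `^ (s - u).
Proof.
move=> eta0 s0; have [eta1|eta1] := leP 1 eta.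
  exists 0; first by rewrite lexx.
  rewrite subr0 (@le_trans _ _ 1)//; first by lra.
  by rewrite -(powRr0 eta) ler_powR// ltW.
have leta : ln eta < 0 by rewrite ln_lt0// eta0.
have l2 : 0 < ln (2 : R) by rewrite ln_gt0// ltr1n.
pose e := Num.min s (ln 2 / - ln eta).
have e0 : 0 < e by rewrite lt_min s0 divr_gt0// oppr_gt0.
have es : e <= s by rewrite ge_min lexx.
exists (s - e); first by lra.
rewrite opprB addrC subrK /powR gt_eqF//.
rewrite -[leLHS]lnK ?posrE ?invr_gt0// ler_expR lnV ?posrE//.
rewrite lerNl -mulrN -ler_pdivlMr ?oppr_gt0//.
by rewrite ge_min lexx orbT.
Qed.

Lemma cheap_lower_exponent F s u eta x rho : 0 < eta -> 0 < s -> 0 <= u <= s ->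
  2^-1 <= eta `^ (s - u) -> cheaply_covered F s eta x rho ->
  exists l, [/\ forall b, b \in l -> eta <= b.2 /\ 2 * b.2 <= 2^-1,
       cover_cost u l <= 1 & relative_cover F x rho l].
Proof.
move=> eta0 s0 /andP[u0 us] eta_half [l [l_eta lcost lcov]].
exists l; split=> //.
  move=> b bl; split; first exact: l_eta.
  rewrite leNgt; apply/negP => b_big.
  have : 2^-1 `^ s < (2 * b.2) `^ s :> R.
    by rewrite gt0_ltr_powR// ?nnegrE ?invr_ge0//; have := l_eta b bl; lra.
  apply/negP; rewrite -leNgt.
  apply: (@le_trans _ _ (cover_cost s l)).
    rewrite /cover_cost (big_rem b)//= lerDl sumr_ge0// => c _.
    exact: powR_ge0.
  apply: le_trans lcost _; rewrite ler_piMr ?powR_ge0//; lra.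
have : cover_cost u l <= 2 * cover_cost s l.
  rewrite /cover_cost mulr_sumr big_seq [leRHS]big_seq.
  apply: ler_sum => b /l_eta bl.
  have b0 : 0 < 2 * b.2 by lra.
  rewrite -[X in _ <= 2 * _ `^ X](subrK u s) powRD; last first.
    by rewrite (gt_eqF b0) implybT.
  rewrite mulrA ler_peMl ?powR_ge0//.
  have : eta `^ (s - u) <= (2 * b.2) `^ (s - u).
    by rewrite ge0_ler_powR// ?nnegrE ?subr_ge0//; lra.
  by move: eta_half; lra.
have : 2^-1 `^ s <= 1 :> R.
  by apply: powR_le1; [lra|exact: ltW].
by move: lcost; lra.
Qed.

Lemma assouad_exponent_ge F s a : dimA euclid_dist F = s%:E -> 0 <= a ->
  assouad_exponent euclid_dist F a -> s <= a.
Proof.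
move=> Fs a0 Fa; rewrite -lee_fin -Fs; apply: ereal_inf_lbound.
by exists a.
Qed.

(** Otherwise, inside a rich ball all balls of much smaller radius are cheaply
covered, and their covers can be refined with an exponent [u < s]. Passing to
these smaller balls costs the doubling constant, once; every ball that is not
rich is refined with the exponent [u] as well. So [u] would be an exponent for
[F]. *)
Lemma nested_rich_balls F s eta : (0 < n)%N -> 0 < s ->
  dimA euclid_dist F = s%:E -> 0 < eta <= 1 ->
  exists z : 'rV[R]_n * R * ('rV[R]_n * R),
    let: (x, rho, (y, r)) := z in
    [/\ [/\ F x, 0 < rho & ~ cheaply_covered F s eta x rho],
        [/\ F y, 0 < r & ~ cheaply_covered F s eta y r],
        euclid_dist x y <= rho & r <= eta * rho].
Proof.
move=> n0 s0 Fs /andP[eta0 eta1]; apply: contrapT => norich.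
have [u /andP[u0 us] eta_half] := powR_half_le eta0 s0.
have u_le : 0 <= u <= s by rewrite u0 ltW.
have [K doubling] :=
  @euclidean_doubling R n (eta / 2) (divr_gt0 eta0 (ltr0Sn _ 1)).
pose C1 := eta `^ (- u).
have C1_ge1 : 1 <= C1.
  rewrite /C1 powRN invf_ge1 ?powR_gt0//.
  by apply: powR_le1 => //; rewrite eta1 ltW.
have C1_0 : 0 <= C1 by lra.
suff : net_exponent euclid_dist F u.
  move=> /(net_assouad_exponent n0 u0) /(assouad_exponent_ge Fs u0).
  by rewrite leNgt us.
exists (K.+1%:R * C1); first by rewrite mulr_gt0// (lt_le_trans _ C1_ge1).
have C12 : C1 <= K.+1%:R * C1 by rewrite ler_peMl// ler1n.
move=> x0 r0 rho0 Fx0 r0_gt0 r0_rho0.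
apply: (@iterate_covers _ _ F eta u _ rho0) => //; last by nra.
move=> {x0 r0 Fx0 r0_gt0 r0_rho0} x rho Fx rho_gt0 _.
have [cheap|rich] := pselect (cheaply_covered F s eta x rho).
  by left; exact: cheap_lower_exponent cheap.
right => r r_gt0 r_rho.
set A := F `&` cball euclid_dist x rho.
have below z t rr : A z -> 0 < rr -> t <= eta * rho -> eta * rr <= t ->
    bounded_cover (A `&` cball euclid_dist z t) (C1 * (t / rr) `^ u) rr.
  apply: (@iterate_covers _ _ A eta u _ (eta * rho)) => // y t' [Fy xy] t'0 t'R.
  left; have cheap : cheaply_covered F s eta y t'.
    apply: contrapT => yrich; apply: norich.
    by exists (x, rho, (y, t')); split.
  have [l [l1 l2 l3]] := cheap_lower_exponent eta0 s0 u_le eta_half cheap.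
  by exists l; split=> // w [Fw _]; exact: l3.
have ratio : 0 <= rho / r by rewrite divr_ge0 ?ltW.
have [L LK Lcov] := doubling x rho rho_gt0.
have : bounded_cover A (\sum_(p <- L) C1 * (rho / r) `^ u) r.
  apply: (@bounded_cover_seq _ _ _ _
    (fun p => cball euclid_dist p (eta / 2 * rho))).
    by move=> y [_ /Lcov[p pL py]]; exists p.
  move=> p pL.
  have [[z [Az pz]]|] :=
    pselect (A `&` cball euclid_dist p (eta / 2 * rho) !=set0); last first.
    by move=> /(@bounded_cover0 _ _ _ r); apply: bounded_coverS => //;
      rewrite mulr_ge0 ?powR_ge0.
  have := below z (eta * rho) r Az r_gt0 (lexx _).
  rewrite ler_pM2l// => /(_ (ltW r_rho)); apply: bounded_coverS.
    move=> y [Ay py]; split=> //; rewrite /cball/=.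
    apply: le_trans (euclid_dist_triangle p _ _) _.
    rewrite euclid_distC.
    rewrite (_ : eta * rho = eta / 2 * rho + eta / 2 * rho); last by field.
    exact: lerD.
  rewrite ler_wpM2l// ge0_ler_powR// ?nnegrE//.
    by rewrite divr_ge0 ?mulr_ge0 ?ltW.
  by rewrite ler_pM2r ?invr_gt0// ler_piMl// ltW.
apply: bounded_coverS => //.
rewrite big_const_seq count_predT iter_addr_0 -[leLHS]mulr_natl -mulrA.
rewrite ler_wpM2r ?mulr_ge0 ?powR_ge0// (le_trans LK)// ler_nat//.
Qed.

End rich_balls.

(** * Limits of rescaled sets *)

Section limit_sets.
Context {R : realType} {n : nat}.
Implicit Types (x y p q : 'rV[R]_n) (F A K O : set 'rV[R]_n) (r rho eta u s : R).

Definition rescale y rho q : 'rV[R]_n := rho^-1 *: (q - y).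

Lemma euclid_dist_rescale y rho p q : 0 < rho ->
  euclid_dist (rescale y rho p) (rescale y rho q) = rho^-1 * euclid_dist p q.
Proof.
move=> rho0; rewrite /euclid_dist /rescale -scalerBr opprB addrA subrK enormZ.
by rewrite gtr0_norm// invr_gt0.
Qed.

Context (U : set_system nat) (UU : UltraFilter U) (Uoo : \oo `<=` U).
Variables (F : set 'rV[R]_n) (y : nat -> 'rV[R]_n) (t : nat -> R).
Hypothesis t0 : forall k, 0 < t k.

Definition limit_set : set 'rV[R]_n :=
  [set p | forall e, 0 < e ->
    \forall k \near U, exists2 q, F q &
      euclid_dist (rescale (y k) (t k) q) p < e].

(** The sequence consists of almost nearest points, so that one sequence serves
all [e] at once. *)
Lemma limit_setP p : limit_set p -> exists2 q : nat -> 'rV[R]_n,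
  forall k, F (q k) & (fun k => rescale (y k) (t k) (q k)) @ U --> p.
Proof.
move=> Ep.
have [q0 Fq0] : F !=set0.
  by have [k [q Fq _]] := filter_ex (Ep _ ltr01); exists q.
pose D k := [set euclid_dist (rescale (y k) (t k) q) p | q in F].
have Dinf k : has_inf (D k).
  split; first by exists (euclid_dist (rescale (y k) (t k) q0) p); exists q0.
  by exists 0 => _ [q _ <-]; exact: enorm_ge0.
have /choice[q qP] : forall k : nat, exists q, F q /\
    euclid_dist (rescale (y k) (t k) q) p < inf (D k) + k.+1%:R^-1.
  move=> k; have k0 : 0 < k.+1%:R^-1 :> R by rewrite invr_gt0.
  by have [_ [q Fq <-] qk] := inf_adherent k0 (Dinf k); exists q.
exists q; first by move=> k; have [] := qP k.
apply: cvg_euclid => e e0.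
have e2 : 0 < e / 2 by rewrite divr_gt0.
have kU : \forall k \near U, k.+1%:R^-1 < e / 2.
  exact/Uoo/(near_infty_natSinv_lt (PosNum e2)).
apply: filterS2 (Ep _ e2) kU => k [q' Fq' q'e] ke.
have [_ qk] := qP k.
apply: lt_le_trans qk _; rewrite [leRHS]splitr lerD ?(ltW ke)//.
by apply: le_trans (ltW q'e); apply: ge_inf; [have [] := Dinf k|exists q'].
Qed.

Lemma closed_limit_set : closed limit_set.
Proof.
move=> p clp e e0.
have [q [Eq /= pq]] : limit_set `&` [set q | euclid_dist p q < e / 2] !=set0.
  apply: clp; apply: open_nbhs_nbhs; split; first exact: open_eball.
  by rewrite /= euclid_distxx divr_gt0.
apply: filterS (Eq _ (divr_gt0 e0 (ltr0Sn _ 1))) => k [q' Fq' q'e].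
exists q' => //; apply: le_lt_trans (euclid_dist_triangle q _ _) _.
by rewrite (euclid_distC q) [ltRHS]splitr ltrD.
Qed.

(** Points of the rescaled copies that stay in [K] and outside [O] would have a
cluster point, which would be a point of the limit set outside [O]. *)
Lemma limit_set_near_subset K O : compact K -> open O ->
  limit_set `&` K `<=` O ->
  \forall k \near U, forall q, F q -> K (rescale (y k) (t k) q) ->
    O (rescale (y k) (t k) q).
Proof.
move=> cK oO EKO.
pose P k := forall q, F q -> K (rescale (y k) (t k) q) ->
  O (rescale (y k) (t k) q).
have [//|UnP] := in_ultra_setVsetC P UU.
have /choice[q qP] : forall k, exists q, (~` P) k ->
    [/\ F q, K (rescale (y k) (t k) q) & ~ O (rescale (y k) (t k) q)].
  move=> k.
  have [Pk|/existsNP[q /not_implyP[Fq /not_implyP[Kq Oq]]]] := pselect (P k).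
    by exists 0 => /(_ Pk).
  by exists q.
pose z k := rescale (y k) (t k) (q k).
have zP : \forall k \near U, [/\ F (q k), K (z k) & ~ O (z k)].
  exact: filterS qP UnP.
have UP : ProperFilter U by exact: (@ultra_proper _ _ UU).
have [p [Kp zp]] : (K `&` cluster (z @ U)) !=set0.
  by apply: cK; apply: filterS zP => k [].
have Ep : limit_set p.
  move=> e e0; pose B := [set w | euclid_dist p w < e].
  have pB : nbhs p B.
    by apply: open_nbhs_nbhs; split; [exact: open_eball|rewrite /B/= euclid_distxx].
  have [UB|UnB] := in_ultra_setVsetC (z @^-1` B) UU.
    apply: filterS2 UB zP => k Bk [Fk _ _].
    by exists (q k) => //; rewrite euclid_distC.
  by have [w [nBw Bw]] := zp (~` B) B UnB pB.
have Op : nbhs p O by apply: open_nbhs_nbhs; split=> //; exact: EKO.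
have [|w [nOw Ow]] := zp (~` O) O _ Op; last by [].
by apply: filterS zP => k [].
Qed.

(** A cover of the limit set by finitely many open balls also covers the
rescaled copies of [F] for many [k]; since [eta] tends to 0, the radii are
eventually large enough for it to contradict richness. The radius 2 ensures
that the rescaled ball around [x k], which contains the origin and has radius 1,
is covered. *)
Lemma rich_limit_set s (eta : nat -> R) (x : nat -> 'rV[R]_n) :
  (forall k, ~ cheaply_covered F s (eta k) (x k) (t k)) ->
  (forall k, euclid_dist (x k) (y k) <= t k) -> eta @ U --> 0 ->
  forall l : seq ('rV[R]_n * R), (forall b, b \in l -> 0 < b.2) ->
    cover_cost s l <= 2^-1 `^ s / 2 ->
    ~ (limit_set `&` cball euclid_dist 0 2 `<=`
       \bigcup_(b in [set` l]) [set p | euclid_dist b.1 p < b.2]).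
Proof.
move=> rich xy eta0 l l0 lcost lcov.
have UP : ProperFilter U by exact: (@ultra_proper _ _ UU).
have Uk := limit_set_near_subset (@compact_cball R n 0 2)
  (bigcup_open (fun b _ => @open_eball R n b.1 b.2)) lcov.
have Ueta : \forall k \near U, forall b, b \in l -> eta k < b.2.
  by apply: near_all_seq => b /l0 b0; apply: (cvgr_lt _ eta0).
have [k [kcov keta]] := filter_ex (filterI Uk Ueta).
apply: (rich k).
have tk := t0 k.
exists [seq (y k + t k *: b.1, b.2) | b <- l]; split.
- by move=> _ /mapP[b bl ->] /=; exact/ltW/keta.
- by rewrite /cover_cost big_map.
- move=> q Fq xq.
  have [|b bl bq] := kcov q Fq.
    rewrite /cball/= (_ : 0 = rescale (y k) (t k) (y k)); last first.
      by rewrite /rescale subrr scaler0.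
    rewrite euclid_dist_rescale// ler_pdivrMl//.
    apply: le_trans (euclid_dist_triangle (x k) _ _) _.
    by rewrite mulr_natr mulr2n lerD// euclid_distC.
  exists (y k + t k *: b.1, b.2); first exact: map_f.
  move: bq; rewrite /cball /=.
  have {1}-> : b.1 = rescale (y k) (t k) (y k + t k *: b.1).
    by rewrite /rescale addrC addKr scalerA mulVf ?scale1r// gt_eqF.
  by rewrite euclid_dist_rescale// ltr_pdivrMl// mulrC => /ltW.
Qed.

End limit_sets.

(** * Dimensions of limit sets *)

Lemma powR_small (R : realType) (e c : R) : 0 < e -> 0 < c ->
  exists2 r, 0 < r <= 1 & r `^ e <= c.
Proof.
move=> e0 c0; exists (Num.min 1 (c `^ e^-1)).
  by rewrite lt_min ltr01 powR_gt0//= ge_min lexx.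
have {2}-> : c = (c `^ e^-1) `^ e.
  by rewrite -powRrM mulVf ?gt_eqF// powRr1 ?ltW.
rewrite ge0_ler_powR ?nnegrE ?(ltW e0) ?powR_ge0//.
  by rewrite le_min ler01 powR_ge0.
by rewrite ge_min lexx orbT.
Qed.

Lemma real_dist_triangle (R : realType) (a b c : R) :
  real_dist a c <= real_dist a b + real_dist b c.
Proof. exact: ler_distD. Qed.

Lemma real_distC (R : realType) (a b : R) : real_dist a b = real_dist b a.
Proof. exact: distrC. Qed.

Section limit_set_dimension.
Context {R : realType} {n : nat}.
Implicit Types (p q : 'rV[R]_n) (r rho u s : R).
Context (U : set_system nat) (UU : UltraFilter U) (Uoo : \oo `<=` U).
Variables (F : set 'rV[R]_n) (y : nat -> 'rV[R]_n) (t : nat -> R).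
Hypothesis t0 : forall k, 0 < t k.
Hypothesis Fy : forall k, F (y k).

Let T := limit_set U F y t.

Lemma limit_set0 : T 0.
Proof.
move=> e e0; apply: (@filterE _ U) => k; exists (y k) => //.
by rewrite /rescale subrr scaler0 euclid_distxx.
Qed.

Lemma limit_set_choice : exists Q : 'rV[R]_n -> nat -> 'rV[R]_n,
  (forall p k, T p -> F (Q p k)) /\
  (forall p, T p -> (fun k => rescale (y k) (t k) (Q p k)) @ U --> p).
Proof.
have /choice[Q QP] : forall p, exists q : nat -> 'rV[R]_n, T p ->
    (forall k, F (q k)) /\ (fun k => rescale (y k) (t k) (q k)) @ U --> p.
  move=> p; have [Tp|nTp] := pselect (T p); last by exists y.
  by have [q] := limit_setP UU Uoo Tp; exists q.
by exists Q; split=> [p k|p] /(QP p)[].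
Qed.

Lemma limit_set_net_exponent a : 0 <= a ->
  net_exponent euclid_dist F a -> net_exponent euclid_dist T a.
Proof.
move=> a0; have UP : ProperFilter U by exact: (@ultra_proper _ _ UU).
have [Q [FQ TQ]] := limit_set_choice.
apply: (@limit_net_exponent _ _ _ _ _ _ _ U UP (fun k => (t k)^-1)
  (fun k p => Q p k)) => //.
- by move=> *; exact: euclid_dist_triangle.
- exact: euclid_distC.
- by move=> k; rewrite invr_gt0.
- by move=> k p Tp; exact: FQ.
- move=> p q Tp Tq.
  rewrite [X in X @ _ --> _](_ : _ = fun k =>
    enorm (rescale (y k) (t k) (Q p k) - rescale (y k) (t k) (Q q k))).
    by apply: cvg_enorm; apply: cvgB; exact: TQ.
  by apply/funext => k; rewrite -(euclid_dist_rescale (y k)).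
Qed.

(** An exponent [a < s] of the limit set would yield covers by balls of radius
[r] whose cost of exponent [s] is of order [r `^ (s - a)], hence arbitrarily
small. *)
Lemma limit_set_dimA s (eta : nat -> R) : (0 < n)%N -> 0 < s ->
  dimA euclid_dist F = s%:E -> eta @ U --> 0 ->
  (forall k, ~ cheaply_covered F s (eta k) (y k) (t k)) ->
  dimA euclid_dist T = s%:E.
Proof.
move=> n0 s0 Fs eta0 rich; apply/eqP; rewrite eq_le; apply/andP; split.
  rewrite -Fs; apply: le_ereal_inf => _ [a [a0 Fa] <-]; exists a => //; split=> //.
  by apply/net_assouad_exponent/limit_set_net_exponent/assouad_net_exponent.
apply: le_ereal_inf_tmp => _ [a [a0 Ta] <-]; rewrite lee_fin leNgt.
apply/negP => a_s.
have [C C0 TC] := assouad_net_exponent Ta.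
have sa0 : 0 < s - a by rewrite subr_gt0.
have c0 : 0 < 2^-1 `^ s / 2 / (C * 2 `^ a * 4 `^ s) :> R.
  by rewrite !divr_gt0 ?mulr_gt0 ?powR_gt0 ?invr_gt0.
have [r /andP[r0 r1] rc] := powR_small sa0 c0.
have [|L Lsize Lcov] := TC 0 r 2 limit_set0 r0.
  by rewrite (le_lt_trans r1)// ltr1n.
apply: (@rich_limit_set R n U UU F y t t0 s eta y rich _ eta0
  [seq (p, 2 * r) | p <- L]) => //.
- by move=> k; rewrite euclid_distxx ltW.
- by move=> _ /mapP[p _ ->]; rewrite mulr_gt0.
- rewrite /cover_cost big_map/= big_const_seq count_predT iter_addr_0.
  rewrite -[_ *+ size L]mulr_natr.
  have -> : 2 * (2 * r) = 4 * r by lra.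
  rewrite powRM ?(ltW r0)//.
  apply: (@le_trans _ _ (4 `^ s * r `^ s * (C * (2 / r) `^ a))).
    by rewrite ler_wpM2l// mulr_ge0 ?powR_ge0.
  rewrite powRM ?invr_ge0 ?(ltW r0)// -(powR_inv1 (ltW r0)) -powRrM mulN1r.
  move: rc; rewrite ler_pdivlMr ?mulr_gt0 ?powR_gt0// powRD.
    by move=> {}rc; lra.
  by rewrite (gt_eqF r0) implybT.
- move=> p [Tp p2]; have [|q qL qp] := Lcov p; first by split.
  exists (q, 2 * r); first exact: map_f.
  by rewrite /= (le_lt_trans qp)// mulr_natl mulr2n ltrDl.
Qed.

(** The norm of a limit of rescaled points is the limit of distances between
points of [F]. *)
Lemma limit_set_radial_exponent a : 0 <= a ->
  net_exponent (@real_dist R) (distance_set F) a ->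
  net_exponent (@real_dist R) (enorm @` T) a.
Proof.
move=> a0; have UP : ProperFilter U by exact: (@ultra_proper _ _ UU).
have [Q [FQ TQ]] := limit_set_choice.
have /choice[sel selP] : forall v, exists p, (enorm @` T) v -> T p /\ enorm p = v.
  move=> v; have [[p Tp pv]|nv] := pselect ((enorm @` T) v); last by exists 0.
  by exists p.
apply: (@limit_net_exponent _ _ _ _ _ _ _ U UP (fun k => (t k)^-1)
  (fun k v => euclid_dist (Q (sel v) k) (y k))) => //.
- by move=> *; exact: real_dist_triangle.
- exact: real_distC.
- by move=> k; rewrite invr_gt0.
- move=> k v /selP[Tp _]; exists (Q (sel v) k); first exact: FQ.
  by exists (y k).
- move=> v w /selP[Tv ev] /selP[Tw ew].
  rewrite [X in X @ _ --> _](_ : _ = fun k => `|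
    enorm (rescale (y k) (t k) (Q (sel v) k)) -
    enorm (rescale (y k) (t k) (Q (sel w) k))|).
    have -> : real_dist v w = `|enorm (sel v) - enorm (sel w)| by rewrite ev ew.
    by apply: cvg_norm; apply: cvgB; [exact: (cvg_enorm (TQ _ Tv))|
      exact: (cvg_enorm (TQ _ Tw))].
  apply/funext => k; have tk : 0 < (t k)^-1 by rewrite invr_gt0.
  by rewrite /rescale !enormZ -mulrBr normrM normr_id (gtr0_norm tk).
Qed.

End limit_set_dimension.

(** * Projections onto lines as limits of distances *)

Section projections_onto_lines.
Context {R : realType} {n : nat}.
Implicit Types (x p q : 'rV[R]_n) (F : set 'rV[R]_n).

Lemma oproj_line x p : x != 0 -> oproj <[x]>%VS p = (dotv p x / dotv x x) *: x.
Proof.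
move=> x0; apply: oproj_unique; first by rewrite memvZ ?memv_line.
move=> _ /vlineP[c ->]; rewrite !dotvE mulrCA.
by rewrite mulfVK ?subrr ?mulr0// -enorm_sqr expf_neq0// gt_eqF ?enorm_gt0.
Qed.

Lemma euclid_dist_oproj_line x p q : x != 0 ->
  euclid_dist (oproj <[x]>%VS p) (oproj <[x]>%VS q) =
    `|dotv p x / enorm x - dotv q x / enorm x|.
Proof.
move=> x0; have ex := enorm_gt0 x0.
rewrite /euclid_dist !oproj_line// -scalerBl enormZ -enorm_sqr -!mulrBl.
rewrite -{2}(gtr0_norm ex) -normrM; congr (`|_|); field.
by rewrite gt_eqF.
Qed.

(** The difference of squares turns the difference quotient of the norm into an
expression that is continuous at [a = 0]. When both norms vanish, both sides are
zero. *)
Lemma enorm_sub_difference_quotient (g h : 'rV[R]_n) (a : R) : 0 < a ->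
  (enorm (g - a *: h) - enorm g) / a =
    (a * dotv h h - 2 * dotv g h) / (enorm (g - a *: h) + enorm g).
Proof.
move=> a0.
have sq : (enorm (g - a *: h) - enorm g) * (enorm (g - a *: h) + enorm g) =
    a * (a * dotv h h - 2 * dotv g h).
  rewrite -subr_sqr !enorm_sqr !dotvE (dotvC h g); ring.
have [s0|s0] := eqVneq (enorm (g - a *: h) + enorm g) 0.
  have A0 := enorm_ge0 (g - a *: h); have B0 := enorm_ge0 g.
  have -> : enorm (g - a *: h) = 0 by lra.
  have -> : enorm g = 0 by lra.
  by rewrite subr0 addr0 invr0 !mulr0 mul0r.
apply/eqP; rewrite eqr_div ?(gt_eqF a0)// sq; apply/eqP; ring.
Qed.

Context (U : set_system nat) (UU : UltraFilter U) (Uoo : \oo `<=` U).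
Variables (F : set 'rV[R]_n) (y : nat -> 'rV[R]_n) (tbig tsmall : nat -> R).
Hypothesis tbig0 : forall k, 0 < tbig k.
Hypothesis tsmall0 : forall k, 0 < tsmall k.
Hypothesis ratio0 : (fun k => tsmall k / tbig k) @ U --> 0.

(** The derivative of the distance to a point of direction [x] is, up to sign,
the projection onto the line of [x]; here [z] stays at distance of order
[tbig] from [y], and [q] at the much smaller distance of order [tsmall]. *)
Lemma cvg_distance_quotient (z q : nat -> 'rV[R]_n) x p : x != 0 ->
  (fun k => rescale (y k) (tbig k) (z k)) @ U --> x ->
  (fun k => rescale (y k) (tsmall k) (q k)) @ U --> p ->
  (fun k => (euclid_dist (z k) (q k) - euclid_dist (z k) (y k)) / tsmall k) @ U
    --> - (dotv p x / enorm x).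
Proof.
have UP : ProperFilter U by exact: (@ultra_proper _ _ UU).
move=> x0; set g := fun k => rescale _ _ (z k); set h := fun k => rescale _ _ (q k).
move=> gx hp; have ex := enorm_gt0 x0.
pose a k := tsmall k / tbig k.
have a0 k : 0 < a k by rewrite divr_gt0.
rewrite [X in X @ _ --> _](_ : _ = fun k =>
    (a k * dotv (h k) (h k) - 2 * dotv (g k) (h k)) /
    (enorm (g k - a k *: h k) + enorm (g k))); last first.
  apply/funext => k; rewrite -enorm_sub_difference_quotient//.
  have b0 := tbig0 k; have s0 := tsmall0 k.
  have -> : euclid_dist (z k) (q k) = tbig k * enorm (g k - a k *: h k).
    rewrite /euclid_dist -{1}(gtr0_norm b0) -enormZ scalerBr !scalerA.
    rewrite mulfV ?gt_eqF// scale1r /a mulrCA mulfV ?gt_eqF// mulr1 mulfV ?gt_eqF//.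
    by rewrite scale1r opprB addrA subrK.
  have -> : euclid_dist (z k) (y k) = tbig k * enorm (g k).
    by rewrite /g /rescale enormZ gtr0_norm ?invr_gt0// mulVKf// gt_eqF.
  rewrite /a; field; by rewrite !gt_eqF.
have -> : - (dotv p x / enorm x) =
    (0 * dotv p p - 2 * dotv x p) / (enorm (x - 0 *: p) + enorm x).
  rewrite scale0r subr0 mul0r (dotvC x p); field.
  by rewrite !gt_eqF ?addr_gt0.
have num : (fun k => a k * dotv (h k) (h k) - 2 * dotv (g k) (h k)) @ U -->
    0 * dotv p p - 2 * dotv x p.
  have h1 : (fun k => a k * dotv (h k) (h k)) @ U --> 0 * dotv p p.
    exact: (cvgM ratio0 (cvg_dotv hp hp)).
  have h2 : (fun k => 2 * dotv (g k) (h k)) @ U --> 2 * dotv x p.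
    exact: (cvgM (@cvg_cst R 2 nat U _) (cvg_dotv gx hp)).
  exact: (cvgB h1 h2).
have den : (fun k => enorm (g k - a k *: h k) + enorm (g k)) @ U -->
    enorm (x - 0 *: p) + enorm x.
  have h1 : (fun k => g k - a k *: h k) @ U --> x - 0 *: p.
    exact: (cvgB gx (cvgZ ratio0 hp)).
  exact: (cvgD (cvg_enorm h1) (cvg_enorm gx)).
have denV : (fun k => (enorm (g k - a k *: h k) + enorm (g k))^-1) @ U -->
    (enorm (x - 0 *: p) + enorm x)^-1.
  apply: (cvgV _ den); rewrite scale0r subr0 gt_eqF//.
  exact: addr_gt0.
exact: (cvgM num denV).
Qed.

(** The points [z k] of [F] approximate the direction [x] at scale [tbig], and
the differences of the distances from [z k] to points of [F] at scale [tsmall]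
approximate distances between projections. *)
Lemma projection_net_exponent x e : (forall k, F (y k)) -> 0 <= e -> x != 0 ->
  limit_set U F y tbig x ->
  net_exponent (@real_dist R) (distance_set F) e ->
  net_exponent euclid_dist (oproj <[x]>%VS @` limit_set U F y tsmall) e.
Proof.
move=> Fy e0 x0 Ex; have UP : ProperFilter U by exact: (@ultra_proper _ _ UU).
set T := limit_set U F y tsmall.
have [z Fz zx] := limit_setP UU Uoo Ex.
have [Q [FQ TQ]] := limit_set_choice UU Uoo F y tsmall.
have /choice[sel selP] : forall v, exists p, (oproj <[x]>%VS @` T) v ->
    T p /\ oproj <[x]>%VS p = v.
  move=> v; have [[p Tp pv]|nv] := pselect ((oproj <[x]>%VS @` T) v).
    by exists p.
  by exists 0.
apply: (@limit_net_exponent _ _ _ _ _ _ _ U UP (fun k => (tsmall k)^-1)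
  (fun k v => euclid_dist (z k) (Q (sel v) k))) => //.
- by move=> *; exact: real_dist_triangle.
- exact: real_distC.
- by move=> k; rewrite invr_gt0.
- move=> k v /selP[Tp _]; exists (z k); first exact: Fz.
  by exists (Q (sel v) k) => //; exact: FQ.
- move=> v w /selP[Tv ev] /selP[Tw ew].
  have -> : euclid_dist v w =
      `|- (dotv (sel v) x / enorm x) - - (dotv (sel w) x / enorm x)|.
    by rewrite -{1}ev -{1}ew euclid_dist_oproj_line// -opprD normrN.
  rewrite [X in X @ _ --> _](_ : _ = fun k => `|
    (euclid_dist (z k) (Q (sel v) k) - euclid_dist (z k) (y k)) / tsmall k -
    (euclid_dist (z k) (Q (sel w) k) - euclid_dist (z k) (y k)) / tsmall k|).
    apply: cvg_norm; apply: cvgB; apply: cvg_distance_quotient => //; exact: TQ.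
  apply/funext => k; have tk : 0 < (tsmall k)^-1 by rewrite invr_gt0.
  rewrite -mulrBl normrM (gtr0_norm tk) mulrC /real_dist; congr (`|_| * _).
  ring.
Qed.

End projections_onto_lines.

(** * Points with nearby lines and nearby norms *)

Section polar_coordinates.
Context {R : realType} {n : nat}.
Implicit Types (x p q : 'rV[R]_n) (V W : {vspace 'rV[R]_n}).

Lemma enorm_oproj_le V x : enorm (oproj V x) <= enorm x.
Proof.
have [Vp pV] := oprojP V x.
rewrite -(@ler_pXn2r _ 2)// ?nnegrE ?enorm_ge0// !enorm_sqr.
have := dotvv_ge0 (x - oproj V x).
have := pV _ Vp; rewrite !dotvE (dotvC (oproj V x) x); lra.
Qed.

(** The supremum defining the distance is taken over a bounded set, as
orthogonal projections do not increase norms. *)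
Lemma subspace_dist_ge V W x : enorm x <= 1 ->
  enorm (oproj V x - oproj W x) <= subspace_dist V W.
Proof.
move=> x1; apply: ub_le_sup; last by exists x.
exists 2 => _ [z z1 <-].
apply: le_trans (enorm_triangle _ _) _; rewrite enormN.
by have := enorm_oproj_le V z; have := enorm_oproj_le W z; move: z1 => /=; lra.
Qed.

(** The quantitative form, for points at distance at most 2 from the origin, of
the fact that a point is determined up to sign by its norm and its line. *)
Lemma polar_coordinates_dist x p r : x != 0 -> p != 0 -> enorm x <= 2 ->
  `|enorm x - enorm p| <= 2 * r -> subspace_dist <[x]>%VS <[p]>%VS <= r ->
  euclid_dist x p <= 6 * r \/ euclid_dist (- x) p <= 6 * r.
Proof.
move=> x0 p0 x2 xp dr.
have ex := enorm_gt0 x0; have ep := enorm_gt0 p0.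
pose u := (enorm x)^-1 *: x; pose v := (enorm p)^-1 *: p.
have u1 : enorm u = 1 by rewrite enormZ gtr0_norm ?invr_gt0// mulVf// gt_eqF.
have v1 : enorm v = 1 by rewrite enormZ gtr0_norm ?invr_gt0// mulVf// gt_eqF.
have uu : dotv u u = 1 by rewrite -enorm_sqr u1 expr1n.
have vv : dotv v v = 1 by rewrite -enorm_sqr v1 expr1n.
have xu : x = enorm x *: u by rewrite scalerA mulfV ?scale1r// gt_eqF.
have pv : p = enorm p *: v by rewrite scalerA mulfV ?scale1r// gt_eqF.
have ux : u \in <[x]>%VS by rewrite memvZ ?memv_line.
have vp : v \in <[p]>%VS by rewrite memvZ ?memv_line.
clearbody u v.
have v0 : v != 0.
  by apply: contraTneq isT => v0; move: v1; rewrite v0 enorm0; lra.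
have lines : <[p]>%VS = <[v]>%VS.
  apply/eqP; rewrite eqEsubv -!memvE; apply/andP; split; last by [].
  by rewrite [X in X \in _]pv memvZ ?memv_line.
pose c := dotv u v.
have gap : enorm (u - c *: v) <= r.
  apply: le_trans dr; have := @subspace_dist_ge <[x]>%VS <[p]>%VS u.
  rewrite u1 lexx => /(_ isT); rewrite lines (oproj_line _ v0) vv divr1.
  rewrite (@oproj_unique _ _ <[x]>%VS u u)// => w _.
  by rewrite subrr -(scale0r u) dotvZl mul0r.
have r0 : 0 <= r by apply: le_trans gap; exact: enorm_ge0.
have gap2 : 1 - c ^+ 2 <= r ^+ 2.
  have : enorm (u - c *: v) ^+ 2 <= r ^+ 2 by rewrite ler_pXn2r// nnegrE enorm_ge0.
  by rewrite enorm_sqr !dotvE uu vv (dotvC v u) -/c; lra.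
have c1 : `|c| <= 1 by have := cauchy_schwarz u v; rewrite u1 v1 mulr1.
(* The unit vectors satisfy |sg u - v|^2 = 2 - 2|c| <= 2 (1 - c^2) <= 2 r^2. *)
have key (sg : R) : sg ^+ 2 = 1 -> sg * c = `|c| ->
    euclid_dist (sg *: x) p <= 6 * r.
  move=> sg2 sgc.
  have -> : euclid_dist (sg *: x) p =
      enorm (enorm x *: (sg *: u - v) + (enorm x - enorm p) *: v).
    rewrite /euclid_dist {1}xu {1}pv; congr enorm.
    rewrite scalerBr scalerBl !scalerA (mulrC sg).
    by rewrite addrA subrK.
  apply: le_trans (enorm_triangle _ _) _.
  rewrite !enormZ v1 mulr1 gtr0_norm//.
  have : enorm (sg *: u - v) <= 2 * r.
    rewrite -(@ler_pXn2r _ 2)// ?nnegrE ?enorm_ge0 ?mulr_ge0//.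
    rewrite enorm_sqr !dotvE uu vv (dotvC v u) -/c exprMn.
    move: sg2 sgc; rewrite expr2 => sg2 sgc.
    have cc : c ^+ 2 = `|c| ^+ 2 by rewrite real_normK ?num_real.
    have cn : 0 <= `|c| by [].
    nra.
  have := enorm_ge0 (sg *: u - v); nra.
(* The sign of [c] tells which of the two unit vectors of the line is near. *)
have [c0|c0] := leP 0 c; [left|right].
  by rewrite -(scale1r x); apply: key; rewrite ?expr1n ?mul1r// ger0_norm.
by rewrite -scaleN1r; apply: key; rewrite ?sqrrN ?expr1n// mulN1r ltr0_norm.
Qed.

End polar_coordinates.

(** * Covers in polar coordinates *)

Section null_sets.
Context {R : realType} {T : Type}.
Implicit Types (d : T -> T -> R) (S U : set T) (a b e : R).

Lemma diam_ge0 d U : (0 <= diam d U)%E.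
Proof. by apply: ereal_sup_ubound; left. Qed.

Lemma diam_pow_ge0 d a U : (0 <= diam_pow d a U)%E.
Proof. by rewrite /diam_pow; case: ifP => // _; exact: poweR_ge0. Qed.

Lemma sum_half_pow_le1 N : \sum_(i < N) 2^-1 ^+ i.+1 <= 1 :> R.
Proof.
suff -> : \sum_(i < N) 2^-1 ^+ i.+1 = 1 - 2^-1 ^+ N :> R.
  by rewrite lerBlDr lerDl exprn_ge0 ?invr_ge0.
elim: N => [|N IH]; first by rewrite big_ord0 expr0 subrr.
rewrite big_ord_recr/= IH exprS; lra.
Qed.

(** The radii [r] are positive although the diameters of the sets may vanish:
they are the maximum of the diameter and a positive term of a fast decreasing
sequence. This is affordable because [b] is positive, and [b > a] absorbs the
convention on the exponent 0. *)
Lemma null_set_cover d S a b e : 0 <= a < b ->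
  hausdorff_measure d a S = 0%E -> 0 < e ->
  exists (U : nat -> set T) (r : nat -> R), [/\ forall i, 0 < r i <= 1,
    forall i, (diam d (U i) <= (r i)%:E)%E, S `<=` \bigcup_i U i &
    forall N, \sum_(i < N) r i `^ b <= e].
Proof.
move=> /andP[a0 ab] S0 e0; have b0 : 0 < b by exact: le_lt_trans ab.
have e2 : 0 < e / 2 by rewrite divr_gt0.
have : (hausdorff_premeasure d a 1 S < (e / 2)%:E)%E.
  apply: (@le_lt_trans _ _ 0%E); last by rewrite lte_fin.
  by rewrite -S0; apply: ereal_sup_ubound; exists 1 => //=.
move=> /ereal_inf_lt[_ [U [dU SU] <-]] Ue.
have /choice[tau tauP] : forall i : nat, exists w : R,
    0 < w <= 1 /\ w `^ b <= e / 2 * 2^-1 ^+ i.+1.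
  move=> i; have [|w w1 w2] := @powR_small R b (e / 2 * 2^-1 ^+ i.+1) b0.
    by rewrite mulr_gt0// exprn_gt0// invr_gt0.
  by exists w.
pose D i := fine (diam d (U i)).
have DE i : diam d (U i) = (D i)%:E.
  rewrite fineK// ge0_fin_numE ?diam_ge0//.
  exact: le_lt_trans (dU i) (ltry 1).
have D0 i : 0 <= D i by rewrite -lee_fin -DE diam_ge0.
have D1 i : D i <= 1 by rewrite -lee_fin -DE.
exists U, (fun i => Num.max (D i) (tau i)); split.
- move=> i; have [/andP[t0 t1] _] := tauP i.
  by rewrite lt_max t0 orbT ge_max D1 t1.
- by move=> i; rewrite DE lee_fin le_max lexx.
- exact: SU.
move=> N.
have Dpow : \sum_(i < N) D i `^ b <= e / 2.
  rewrite -lee_fin; apply: le_trans (ltW Ue).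
  apply: le_trans (nneseries_lim_ge N _); last by move=> i _ _; exact: diam_pow_ge0.
  rewrite big_mkord -sumEFin; apply: lee_sum => i _.
  rewrite /diam_pow; case: ifPn => [/asboolP U0|_].
    rewrite lee_fin (_ : D i = 0) ?powR0 ?gt_eqF//.
    apply/eqP; rewrite eq_le D0 andbT -lee_fin -DE U0.
    by apply: ge_ereal_sup => _ [->|[x []]].
  rewrite DE poweR_EFin lee_fin.
  have [Di0|Di0] := eqVneq (D i) 0; first by rewrite Di0 powR0 ?gt_eqF ?powR_ge0.
  by rewrite ger_powR ?(ltW ab)// D1 lt_neqAle eq_sym Di0 D0.
apply: (@le_trans _ _ (\sum_(i < N) D i `^ b + \sum_(i < N) tau i `^ b)).
  rewrite -big_split/=; apply: ler_sum => i _.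
  by case: (leP (D i) (tau i)) => _; rewrite ?lerDr ?lerDl powR_ge0.
rewrite [leRHS]splitr lerD//.
apply: (@le_trans _ _ (\sum_(i < N) e / 2 * 2^-1 ^+ i.+1)).
  by apply: ler_sum => i _; have [] := tauP i.
by rewrite -mulr_sumr ler_piMr ?(ltW e2)// sum_half_pow_le1.
Qed.

End null_sets.

Section polar_covers.
Context {R : realType} {n : nat}.
Implicit Types (p q : 'rV[R]_n) (s a c kappa : R) (E : set 'rV[R]_n).

Lemma grassmannian_line p : p != 0 ->
  exists V : grassmannian R n 1, sval V = <[p]>%VS.
Proof.
move=> p0; have dp : \dim <[p]>%VS == 1 by rewrite dim_vline p0.
by exists (exist _ <[p]>%VS dp).
Qed.

Lemma compact_nat_cover (K : set 'rV[R]_n) (O : nat -> set 'rV[R]_n) :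
  compact K -> (forall i, open (O i)) -> K `<=` \bigcup_i O i ->
  exists N, K `<=` \bigcup_(i in [set i | (i < N)%N]) O i.
Proof.
rewrite compact_cover => cK oO KO.
have [|D _ DK] := cK nat setT O _ KO; first by move=> i _; exact: oO.
exists (\max_(i <- finmap.enum_fset D) i).+1 => p /DK[i Di Oi]; exists i => //=.
by rewrite ltnS; exact: leq_bigmax_seq.
Qed.

(** For a set [U] of lines of diameter at most [r], the norms are covered by
intervals of radius [r], and over each interval there are at most two clusters
of points, opposite to each other. The origin, which spans no line, is added to
the centres. *)
Lemma lines_and_norms_cover E c C (U : set (grassmannian R n 1)) r :
  0 <= c -> 0 < C -> 0 < r <= 1 ->
  (diam (@grassmannian_dist R n 1) U <= r%:E)%E ->
  (forall x r rho : R, (enorm @` E) x -> 0 < r -> r < rho ->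
    exists2 l : seq R, (size l)%:R <= C * (rho / r) `^ c &
      ball_cover (@real_dist R)
        ((enorm @` E) `&` cball (@real_dist R) x rho) l r) ->
  E 0 ->
  exists l : seq 'rV[R]_n, [/\ (size l)%:R <= (1 + 2 * C * 2 `^ c) * r `^ (- c),
    0 \in l &
    forall p V, E p -> p != 0 -> enorm p <= 2 -> U V -> sval V = <[p]>%VS ->
      exists2 z, z \in l & euclid_dist z p < 7 * r].
Proof.
move=> c0 C0 /andP[r0 r1] dU EC E0.
have [||L Lsize Lcov] := EC 0 r 2 _ r0; first by exists 0; rewrite ?enorm0.
  by rewrite (le_lt_trans r1)// ltr1n.
pose W v p := [/\ E p, p != 0, enorm p <= 2, `|v - enorm p| <= r &
  exists2 V, U V & sval V = <[p]>%VS].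
have /choice[z zP] : forall v, exists z, W v !=set0 -> W v z.
  by move=> v; have [[z Wz]|] := pselect (W v !=set0); [exists z|exists 0].
exists (0 :: [seq z v | v <- L] ++ [seq - z v | v <- L]); split.
- rewrite /= size_cat !size_map -[(_ + _).+1]add1n !natrD.
  have rc1 : 1 <= r `^ (- c).
    rewrite powRN invf_ge1 ?powR_gt0// powR_le1// r1 ltW//.
  have rinv : r `^ (- c) = r^-1 `^ c.
    by rewrite -mulN1r powRrM powR_inv1// ltW.
  move: Lsize; rewrite powRM ?invr_ge0 ?(ltW r0)// -rinv; lra.
- exact: mem_head.
- move=> p V Ep p0 p2 UV Vp.
  have [|v vL vp] := Lcov (enorm p).
    split; first by exists p.
    by rewrite /cball/= /real_dist sub0r normrN ger0_norm ?enorm_ge0.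
  have [|Ez z0 z2 zv [V' UV' Vz]] := zP v.
    by exists p; split=> //; exists V.
  have dd : subspace_dist <[z v]>%VS <[p]>%VS <= r.
    by rewrite -Vz -Vp; exact: (le_diam dU UV' UV).
  have nn : `|enorm (z v) - enorm p| <= 2 * r.
    rewrite (le_trans (ler_distD v _ _))// distrC mulr_natl mulr2n.
    exact: lerD.
  have lt7 w : w <= 6 * r -> w < 7 * r by lra.
  have [zp|zp] := polar_coordinates_dist z0 p0 z2 nn dd.
    exists (z v); last exact: lt7.
    by rewrite inE mem_cat map_f ?orbT.
  exists (- z v); last exact: lt7.
  by rewrite inE mem_cat (map_f (fun w => - z w) vL) !orbT.
Qed.

(** The set of lines through points of [E] is null for an exponent smaller than
[s - c] and the norms of the points of [E] obey the exponent [c], hence the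
cost of a cover of exponent [s] by products of the two can be made small. *)
Lemma polar_cover E (S : set (grassmannian R n 1)) s a c kappa :
  closed E -> E 0 -> 0 < s -> 0 <= c -> 0 <= a < s - c ->
  hausdorff_measure (@grassmannian_dist R n 1) a S = 0%E ->
  net_exponent (@real_dist R) (enorm @` E) c ->
  (forall p, E p -> p != 0 -> exists2 V, S V & sval V = <[p]>%VS) ->
  0 < kappa ->
  exists l : seq ('rV[R]_n * R), [/\ forall b, b \in l -> 0 < b.2,
    cover_cost s l <= kappa &
    E `&` cball euclid_dist 0 2 `<=`
      \bigcup_(b in [set` l]) [set p | euclid_dist b.1 p < b.2]].
Proof.
move=> clE E0 s0 c0 a_sc S0 [C C0 EC] ES kappa0.
pose M := (1 + 2 * C * 2 `^ c) * 14 `^ s.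
have M0 : 0 < M by rewrite mulr_gt0 ?powR_gt0// addr_gt0// !mulr_gt0// powR_gt0.
have [U [r [r01 dU SU sumr]]] := null_set_cover a_sc S0 (divr_gt0 kappa0 M0).
have r0 i : 0 < r i by have /andP[] := r01 i.
have /choice[L LP] := fun i => 
  lines_and_norms_cover c0 C0 (r01 i) (dU i) EC E0.
pose O i := \bigcup_(z in [set` L i]) [set p | euclid_dist z p < 7 * r i].
have cK : compact (E `&` cball euclid_dist 0 2).
  by rewrite setIC; apply: compact_closedI => //; exact: compact_cball.
have [||N NK] := compact_nat_cover cK (O := O).
- by move=> i; apply: bigcup_open => z _; exact: open_eball.
- move=> p [Ep p2]; have [->|p0] := eqVneq p 0.
    exists 0%N => //; exists 0; first by have [] := LP 0%N.
    by rewrite /= euclid_distxx mulr_gt0.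
  have [V SV Vp] := ES p Ep p0; have [i _ UV] := SU V SV.
  have [_ _ /(_ p V Ep p0)] := LP i.
  case=> //; last by move=> z zL zp; exists i => //; exists z.
  by move: p2; rewrite /cball/= /euclid_dist sub0r enormN.
exists [seq (z, 7 * r i) | i <- iota 0 N, z <- L i]; split.
- by move=> _ /allpairsPdep[i [z [_ _ ->]]]; rewrite mulr_gt0.
- rewrite /cover_cost big_allpairs_dep/=.
  apply: (@le_trans _ _ (\sum_(i <- iota 0 N) M * r i `^ (s - c))).
    apply: ler_sum => i _; rewrite big_const_seq count_predT iter_addr_0.
    rewrite -[_ *+ size _]mulr_natl.
    have [Lsize _ _] := LP i.
    have -> : 2 * (7 * r i) = 14 * r i by ring.
    rewrite powRM ?(ltW (r0 i))//.
    apply: (le_trans (ler_wpM2r _ Lsize)); first by rewrite mulr_ge0 ?powR_ge0.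
    rewrite powRD; last by rewrite (gt_eqF (r0 i)) implybT.
    rewrite /M; lra.
  rewrite -mulr_sumr mulrC -ler_pdivlMr//.
  have := sumr N; rewrite -(big_mkord xpredT (fun i => r i `^ (s - c))).
  by rewrite /index_iota subn0.
- move=> p /NK[i iN [z zL zp]]; exists (z, 7 * r i) => //=.
  by apply/allpairsPdep; exists i, z; split; rewrite // mem_iota.
Qed.

End polar_covers.

(** * The dimension of the distance set *)

Theorem theorem3p3 (R : realType) (n : nat) (hn : (2 <= n)%N)
    (F : set 'rV[R]_n) (hF : F !=set0) :
  (mine (dimA euclid_dist F - theta (dimA euclid_dist F) n 1) 1
     <= dimA (@real_dist R) (distance_set F))%E.
Proof.
have n0 : (0 < n)%N by exact: ltnW.
have dim_ge0 (T : Type) (d : T -> T -> R) (A : set T) : (0 <= dimA d A)%E.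
  by apply: le_ereal_inf_tmp => _ [a [a0 _] <-]; rewrite lee_fin.
have dimH_ge0 (T : Type) (d : T -> T -> R) (A : set T) : (0 <= dimH d A)%E.
  by apply: le_ereal_inf_tmp => _ [a [a0 _] <-]; rewrite lee_fin.
have dim_le (A : set 'rV[R]_n) a : 0 <= a -> net_exponent euclid_dist A a ->
    (dimA euclid_dist A <= a%:E)%E.
  move=> a0 /(net_assouad_exponent n0 a0) Aa.
  by apply: ereal_inf_lbound; exists a.
have [s Fs] : exists s, dimA euclid_dist F = s%:E.
  have [u u0 Fu] := euclidean_finite_exponent F.
  exists (fine (dimA euclid_dist F)); rewrite fineK// ge0_fin_numE//.
  exact: le_lt_trans (dim_le _ _ u0 Fu) (ltry u).
rewrite leNgt; apply/negP => /ereal_inf_lt[_ [t [t0 Dt] <-]].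
rewrite Fs lt_min => /andP[t_s t1].
have exc_le A : dimA euclid_dist A = s%:E ->
    (dimH (@grassmannian_dist R n 1) (@exceptional_set R n 1 A) <=
      theta s%:E n 1)%E.
  by move=> As; apply: ereal_sup_ubound; exists A.
have theta_ge0 : (0 <= theta s%:E n 1 :> \bar R)%E.
  exact: le_trans (dimH_ge0 _ _ _) (exc_le F Fs).
move: theta_ge0 exc_le t_s; case: (theta s%:E n 1) => [th| |] //.
rewrite lee_fin -EFinB lte_fin => th0 exc_le t_s.
have s0 : 0 < s by lra.
have Dt_net := assouad_net_exponent Dt.
(* With these bounds on the radii, the balls become richer and richer, and
   their ratio [tsmall k / tbig k] tends to 0. *)
pose eta (k : nat) : R := k.+1%:R^-1.
have eta01 k : 0 < eta k <= 1 by rewrite invr_gt0 ltr0Sn invf_le1 ?ler1n.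
have /choice[w wP] := fun k => nested_rich_balls n0 s0 Fs (eta01 k).
pose x k := (w k).1.1; pose tbig k := (w k).1.2.
pose y k := (w k).2.1; pose tsmall k := (w k).2.2.
have {}wP k : [/\
    [/\ F (x k), 0 < tbig k & ~ cheaply_covered F s (eta k) (x k) (tbig k)],
    [/\ F (y k), 0 < tsmall k &
        ~ cheaply_covered F s (eta k) (y k) (tsmall k)],
    euclid_dist (x k) (y k) <= tbig k & tsmall k <= eta k * tbig k].
  by move: (wP k); rewrite /x /y /tbig /tsmall; case: (w k) => [[? ?] [? ?]].
have tbig0 k : 0 < tbig k by have [[]] := wP k.
have tsmall0 k : 0 < tsmall k by have [_ []] := wP k.
have Fy k : F (y k) by have [_ []] := wP k.
have [U [UU Uoo]] := @ultraFilterLemma _ _ (@eventually_filter).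
have UP : ProperFilter U by exact: (@ultra_proper _ _ UU).
have etaU : eta @ U --> 0.
  exact: (cvg_trans (cvg_app _ Uoo) (@cvg_harmonic R)).
have ratioU : (fun k => tsmall k / tbig k) @ U --> 0.
  apply: (squeeze_cvgr _ (@cvg_cst R 0 nat U _) etaU).
  apply: filterE => k; have [_ _ _ st] := wP k.
  by rewrite divr_ge0 ?(ltW (tbig0 k)) ?(ltW (tsmall0 k))//= ler_pdivrMr.
pose E := limit_set U F y tbig; pose T := limit_set U F y tsmall.
have Ts : dimA euclid_dist T = s%:E.
  apply: (@limit_set_dimA _ _ _ UU Uoo F y tsmall tsmall0 Fy s eta) => // k.
  by have [_ []] := wP k.
have [_ [a [a0 excT] <-]] :
  exists2 a, [set a%:E | a in [set a : R | 0 <= a /\ hausdorff_measure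
      (@grassmannian_dist R n 1) a (@exceptional_set R n 1 T) = 0%E]] a &
    (a < (s - t)%:E)%E.
  apply: ereal_inf_lt; apply: le_lt_trans (exc_le T Ts) _.
  by rewrite lte_fin; lra.
rewrite lte_fin => a_st.
(* The lines through points of [E] are exceptional for [T], so [E] has a cheap
   cover near the origin; this contradicts the richness of the large balls. *)
have [||||l [l0 lcost lcov]] := @polar_cover R n E (@exceptional_set R n 1 T)
    s a t (2^-1 `^ s / 2) (@closed_limit_set _ _ _ _ _ _ _)
    (limit_set0 UU tbig Fy) s0 t0 _ excT.
- by rewrite a0.
- exact: limit_set_radial_exponent.
- move=> p Ep p0; have [V Vp] := grassmannian_line p0; exists V => //.
  rewrite /exceptional_set/= Ts Vp.
  apply: (@le_lt_trans _ _ t%:E); last by rewrite lt_min t1 lte_fin andbT; lra.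
  apply: dim_le => //.
  exact: (@projection_net_exponent _ _ _ UU Uoo F y tbig tsmall).
- by rewrite divr_gt0 ?powR_gt0.
apply: (@rich_limit_set R n U UU F y tbig tbig0 s eta x _ _ etaU
  l l0 lcost lcov).
- by move=> k; have [[]] := wP k.
- by move=> k; have [] := wP k.
Qed.
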